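(* Let $n\ge 3$. Distinct towers $(g_2,\dots,g_n)$ give distinct Hamiltonian cycles $C$ on $S_n$, where $C$ is the cycle of the tower (regarded as a set of undirected edges).
   Context: Permutations in $S_n$ are multiplied as functions: $(\pi g)(i)=\pi(g(i))$. For $1\le k\le n$, $G_k=\mathrm{Sym}\{1,\dots,k\}$ is the subgroup of $S_n$ of permutations fixing each of $k+1,\dots,n$. A $k$-cycle on $\{1,\dots,k\}$ is an element of $G_k$ that is a single cycle of length $k$. A tower is a sequence $(g_2,\dots,g_n)$ with $g_k\in G_k\setminus G_{k-1}$ such that, setting $g_1:=\mathbf 1$, each $u_k:=g_{k-1}^{-1}g_k$ is a $k$-cycle on $\{1,\dots,k\}$ $(2\le k\le n)$. Words over the alphabet $\{g_2,\dots,g_n\}$: $M_1=\varepsilon$ and $M_k=(M_{k-1}\,g_k)^{k-1}M_{k-1}$ for $2\le k\le n$. Write $M_ng_n=w_1w_2\cdots w_{n!}$ and $p_m=w_1\cdots w_m\in S_n$ (product in $S_n$, $p_0=\mathbf 1$). The cycle of the tower is the Hamiltonian cycle $p_0,p_1,\dots,p_{n!-1},p_{n!}=p_0$ in $\mathrm{Cay}(S_n,\{g_2,\dots,g_n\})$; as an edge set, $C=\{\{p_m,p_{m+1}\}:0\le m<n!\}$. *)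

(* Defs.v *)
From mathcomp Require Import all_boot all_fingroup.

Set Implicit Arguments.
Unset Strict Implicit.
Unset Printing Implicit Defensive.

Import GroupScope.

(* The points 1, ..., n are represented by 'I_n, so {1, ..., k} is the set of
   i : 'I_n with i < k. *)

Section Towers.

Variable n : nat.
Implicit Types (g : seq 'S_n) (x y : 'S_n) (k m : nat).

(* Product of permutations as functions: MathComp's own s * t applies s first. *)
Definition fmul x y : 'S_n := y * x.

Lemma fmulE x y i : fmul x y i = x (y i).
Proof. exact: permM. Qed.

Definition initial_segment k : {set 'I_n} := [set i : 'I_n | (i < k)%N].

Definition symG k : {group 'S_n} := [group of Sym (initial_segment k)].

Definition full_cycle k x : bool :=
  (x \in symG k) && (initial_segment k \in porbits x).

(* The sequence [:: g_2; ...; g_n] is extended by g_1 = 1. *)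
Definition entry g k : 'S_n := nth 1 (1 :: g) k.-1.

Definition tower g : Prop :=
  forall k, (2 <= k <= n)%N ->
    entry g k \in symG k :\: symG k.-1
    /\ full_cycle k (fmul (entry g k.-1)^-1 (entry g k)).

(* The value at k = 0 is a dummy, chosen so that word g 1 = [::]. *)
Fixpoint word g k : seq 'S_n :=
  if k is k'.+1 then
    flatten (nseq k' (rcons (word g k') (entry g k'.+1))) ++ word g k'
  else [::].

Definition closed_word g : seq 'S_n := rcons (word g n) (entry g n).

Definition partial_product g m : 'S_n := foldl fmul 1 (take m (closed_word g)).

Definition tower_cycle g : {set {set 'S_n}} :=
  [set [set partial_product g m; partial_product g m.+1] | m : 'I_(n`!)].

(* Arcs go from x to x a with a in A; A need not be closed under inverses. *)
Definition cayley (A : {set 'S_n}) : rel 'S_n :=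
  fun x y => [exists a in A, y == fmul x a].

End Towers.

(* C is the set of undirected edges of a cycle of e through all vertices. *)
Definition hamiltonian_cycle (T : finType) (e : rel T) (C : {set {set T}}) :
    Prop :=
  exists s : seq T,
    [/\ ucycle e s, (2 < size s)%N, forall x, x \in s
      & C = [set [set x; next s x] | x : T]].

(* Main.v *)
Require Import Defs.
From mathcomp Require Import all_boot all_fingroup.

Set Implicit Arguments.
Unset Strict Implicit.
Unset Printing Implicit Defensive.

Import GroupScope.

(** Write x y for fmul x y, that is y * x, and u_k = g_{k-1}^-1 g_k.

    Hamiltonicity.  By induction on k, the product of M_k is g_k^-1: indeed
    M_k consists of k - 1 blocks M_{k-1} g_k of product g_{k-1}^-1 g_k = u_k
    followed by M_{k-1}, and u_k ^+ (k - 1) = u_k^-1 because u_k is a k-cycle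
    (word_prod_tower).  Hence the prefixes of M_k ending in copy j (from 0) of
    M_{k-1} have as products the u_k ^+ j y, where y is the product of a
    prefix of M_{k-1}.  Since u_k ^+ j sends the point k to every point of
    {1, ..., k} as j varies, the cosets u_k ^+ j G_{k-1} cover G_k, so that by
    induction the prefixes of M_k reach all of G_k (word_visits_symG).  There
    are n! prefixes of M_n and n! permutations, so no vertex is repeated, and
    counting replaces a separate proof of injectivity.  The walk closes up
    because M_n g_n has product g_n^-1 g_n = 1.

    Injectivity.  In a cycle, a vertex and one of its two neighbours determine
    all further vertices (closed_walk_unique).  Both cycles start at 1, so it
    suffices to show that they have the same orientation there.  The
    neighbours of 1 on the cycle of h are h_2 and h_n^-1, and g_2 cannot be
    the latter: it lies in G_2, hence in G_{n-1} as n >= 3, while h_n does not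
    (tower_cycle_second_vertex).  Thus the sequences of vertices agree, so do
    the words, and every g_k occurs as the letter of index k-1 factorial
    (counted from 1). *)

(** * Closed walks *)

Lemma set2_eq (T : finType) (a b c d : T) :
  [set a; b] = [set c; d] -> (a = c /\ b = d) \/ (a = d /\ b = c).
Proof.
move=> E.
have /set2P Ha : a \in [set c; d] by rewrite -E set21.
have /set2P Hb : b \in [set c; d] by rewrite -E set22.
have /set2P Hc : c \in [set a; b] by rewrite E set21.
have /set2P Hd : d \in [set a; b] by rewrite E set22.
by case: Ha Hb Hc Hd => ? [] ? [] ? [] ?;
  (left; split; congruence) || (right; split; congruence).
Qed.

Lemma next_mkseq (T : eqType) (f : nat -> T) N m :
    {in gtn N &, injective f} -> f N = f 0%N -> (m < N)%N ->
  next (mkseq f N) (f m) = f m.+1.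
Proof.
move=> f_inj fN ltmN; have U : uniq (mkseq f N) by apply/mkseq_uniqP.
have fm : f m = nth (f 0%N) (mkseq f N) m by rewrite nth_mkseq.
have mem_fm : f m \in mkseq f N by rewrite fm mem_nth // size_mkseq.
have idx : index (f m) (mkseq f N) = m by rewrite {1}fm index_uniq ?size_mkseq.
case: N ltmN f_inj fN U mem_fm idx {fm} => // N ltmN _ fN _ mem_fm idx.
rewrite next_nth mem_fm idx /mkseq /=.
have [ltm|] := ltnP m N.
  by rewrite (nth_map 0%N) ?size_iota // nth_iota.
move=> leNm; have -> : m = N by apply/eqP; rewrite eqn_leq leNm -ltnS ltmN.
by rewrite nth_default ?fN // size_map size_iota.
Qed.

Lemma closed_walk_hamiltonian (T : finType) (e : rel T) (f : nat -> T) N :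
    (2 < N)%N -> {in gtn N &, injective f} -> f N = f 0%N ->
    (forall x, exists2 m, (m < N)%N & x = f m) ->
    (forall m, (m < N)%N -> e (f m) (f m.+1)) ->
  hamiltonian_cycle e [set [set f m; f m.+1] | m : 'I_N].
Proof.
move=> N_gt2 f_inj fN f_surj f_step; exists (mkseq f N).
have U : uniq (mkseq f N) by apply/mkseq_uniqP.
split=> [|||].
- rewrite /ucycle U andbT; apply: cycle_from_next => // _ /mapP[m mN ->].
  move: mN; rewrite mem_iota add0n => ltmN.
  by rewrite next_mkseq //; apply: f_step.
- by rewrite size_mkseq.
- by move=> x; have [m ltmN ->] := f_surj x; rewrite map_f // mem_iota.
apply/setP=> E; apply/imsetP/imsetP => [[m _ ->]|[x _ ->]].
  by exists (f m); rewrite ?next_mkseq.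
by have [m ltmN ->] := f_surj x; exists (Ordinal ltmN); rewrite ?next_mkseq.
Qed.

(** Each step is forced: the edge leaving the current vertex is an edge of
    the other cycle, and it is not the one just traversed.  The hypothesis
    2 < N rules out a cycle whose two edges at a vertex coincide. *)
Lemma closed_walk_unique (T : finType) (f q : nat -> T) N :
    (2 < N)%N -> {in gtn N &, injective f} -> {in gtn N &, injective q} ->
    f N = f 0%N -> q N = q 0%N -> f 0%N = q 0%N -> f 1%N = q 1%N ->
    [set [set f m; f m.+1] | m : 'I_N] = [set [set q m; q m.+1] | m : 'I_N] ->
  forall m, (m <= N)%N -> f m = q m.
Proof.
move=> N_gt2 f_inj q_inj fN qN fq0 fq1 fqE.
suff fq m : (m < N)%N -> f m = q m /\ f m.+1 = q m.+1.
  by case=> // m /fq[].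
elim: m => // m IHm ltmN; have [fqm fqm1] := IHm (ltnW ltmN); split=> //.
have: [set f m.+1; f m.+2] \in [set [set q m; q m.+1] | m : 'I_N].
  by rewrite -fqE; apply/imsetP; exists (Ordinal ltmN).
case/imsetP=> -[j ltjN] _ /= /set2_eq[] [].
  by rewrite fqm1 => /q_inj -> //; apply.
rewrite fqm1 => qmj fj.
have [ltj1N|leNj1] := ltnP j.+1 N.
  have [jm] : m.+1 = j.+1 by apply: q_inj.
  (* The walk would turn back from f m.+1 to f m. *)
  have ff : f m.+2 = f m by rewrite fj fqm jm.
  have [ltm2N|leNm2] := ltnP m.+2 N.
    have /eqP := f_inj _ _ ltm2N (ltnW ltmN) ff.
    by rewrite -{2}[m]addn0 -addn2 eqn_add2l.
  have Nm : N = m.+2 by apply/eqP; rewrite eqn_leq leNm2 ltmN.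
  have := f_inj 0%N m (ltnW (ltnW N_gt2)) (ltnW ltmN).
  by rewrite -ff -Nm fN => /(_ erefl) m0; rewrite Nm -m0 in N_gt2.
have jN : j.+1 = N by apply/eqP; rewrite eqn_leq leNj1 ltjN.
have := q_inj m.+1 0%N ltmN (ltnW (ltnW N_gt2)).
by rewrite -qN -jN => /(_ qmj).
Qed.

(** * Permutations of initial segments *)

Lemma in_symG n k (x : 'S_n) :
  (x \in symG n k) = perm_on (initial_segment n k) x.
Proof. by rewrite inE. Qed.

Lemma mem_initial_segment n k (i : 'I_n) :
  (i \in initial_segment n k) = (i < k)%N.
Proof. by rewrite inE. Qed.

Lemma symG_sub n k l : (k <= l)%N -> symG n k \subset symG n l.
Proof.
move=> lekl; apply/subsetP=> x; rewrite !in_symG => /subset_trans; apply.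
by apply/subsetP=> i; rewrite !mem_initial_segment => /leq_trans->.
Qed.

Lemma symG_fix n k (x : 'S_n) (i : 'I_n) :
  i = k :> nat -> x \in symG n k.+1 -> x i = i -> x \in symG n k.
Proof.
move=> ik; rewrite !in_symG => /subsetP xS xi; apply/subsetP=> j xj.
have := xS j xj; rewrite !mem_initial_segment ltnS leq_eqVlt => /predU1P[jk|//].
by move: xj; rewrite inE (_ : j = i) ?xi ?eqxx //; apply: val_inj; rewrite /= ik.
Qed.

Lemma card_initial_segment n k : (k <= n)%N -> #|initial_segment n k| = k.
Proof.
move=> lekn; rewrite -sum1_card.
under eq_bigl do rewrite mem_initial_segment.
by rewrite -(big_ord_widen _ (fun=> 1%N) lekn) sum1_card card_ord.
Qed.

Lemma symG1 n (x : 'S_n) : (0 < n)%N -> x \in symG n 1 -> x = 1.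
Proof.
by move=> n_gt0; rewrite in_symG => /perm_on_id->; rewrite ?card_initial_segment.
Qed.

Lemma symGT n (x : 'S_n) : x \in symG n n.
Proof. by rewrite in_symG; apply/subsetP=> i _; rewrite mem_initial_segment. Qed.

Lemma full_cycle_porbit n k (u : 'S_n) (i : 'I_n) :
  full_cycle k u -> (i < k)%N -> porbit u i = initial_segment n k.
Proof.
case/andP=> _ /imsetP[z _ zk]; rewrite -mem_initial_segment zk => iz.
by apply/eqP; rewrite eq_porbit_mem.
Qed.

Lemma full_cycle_expg n k (u : 'S_n) : (k <= n)%N -> full_cycle k u -> u ^+ k = 1.
Proof.
move=> lekn u_cycle; apply/permP=> i; rewrite perm1 permX.
have [ltik|leki] := ltnP i k.
  rewrite -{1}(card_initial_segment lekn) -(full_cycle_porbit u_cycle ltik).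
  exact: iter_porbit.
have ui : u i = i.
  case/andP: u_cycle; rewrite in_symG => /out_perm-> //.
  by rewrite mem_initial_segment -leqNgt.
by elim: k {lekn u_cycle leki} => //= k ->.
Qed.

(** * Words *)

(** Since fmul reverses the product of permutations, concatenating words
    multiplies their products in the opposite order. *)
Definition word_prod n (w : seq 'S_n) : 'S_n := foldl (@fmul n) 1 w.

Lemma word_prod_cat n (s t : seq 'S_n) :
  word_prod (s ++ t) = word_prod t * word_prod s.
Proof.
rewrite /word_prod foldl_cat; move: (foldl _ 1 s) => x.
elim: t x => [|a t IHt] x /=; first by rewrite mul1g.
by rewrite IHt [in RHS]IHt /fmul mulg1 mulgA.
Qed.

Lemma word_prod_rcons n (s : seq 'S_n) a :
  word_prod (rcons s a) = a * word_prod s.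
Proof. by rewrite -cats1 word_prod_cat /word_prod /= /fmul mulg1. Qed.

Lemma word_prod_nseq n j (s : seq 'S_n) :
  word_prod (flatten (nseq j s)) = word_prod s ^+ j.
Proof.
elim: j => [|j IHj]; first by rewrite expg0.
by rewrite /= word_prod_cat IHj -expgSr.
Qed.

Lemma wordS n (g : seq 'S_n) k :
  word g k.+1 = flatten (nseq k (rcons (word g k) (entry g k.+1))) ++ word g k.
Proof. by []. Qed.

Lemma size_word n (g : seq 'S_n) k : (size (word g k.+1)).+1 = k.+1`!.
Proof.
elim: k => // k IHk; rewrite factS -IHk.
rewrite (wordS g k.+1).
rewrite size_cat size_flatten /shape map_nseq sumn_nseq size_rcons -addnS.
by rewrite mulnC mulSn addnC.
Qed.

Lemma prefix_word n (g : seq 'S_n) k :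
  prefix (rcons (word g k.+1) (entry g k.+2)) (word g k.+2).
Proof. by rewrite /= -catA prefix_prefix. Qed.

Lemma word_prefix_word n (g : seq 'S_n) k l :
  (0 < k <= l)%N -> prefix (word g k) (word g l).
Proof.
case: k => // k; rewrite andTb => lekl; rewrite -(subnKC lekl).
elim: (l - _)%N => [|m IHm]; first by rewrite addn0 prefix_refl.
rewrite addnS addSn; apply: prefix_trans (prefix_word _ _).
by rewrite -cats1; apply: prefix_catl; rewrite -addSn.
Qed.

Lemma word_prefix_closed_word n (g : seq 'S_n) k :
  (0 < k < n)%N -> prefix (rcons (word g k) (entry g k.+1)) (closed_word g).
Proof.
case: k => // k; rewrite andTb => ltkn.
rewrite /closed_word -(cats1 (word g n)); apply: prefix_catl.
exact: prefix_trans (prefix_word _ _) (word_prefix_word _ _).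
Qed.

(** The blocks of M_k multiply to u_k ^+ (k - 1), which is u_k^-1 since a
    k-cycle has k-th power 1. *)
Lemma word_prod_tower n (g : seq 'S_n) k : tower g -> (0 < k <= n)%N ->
  word_prod (word g k) = (entry g k)^-1.
Proof.
move=> g_tower; case: k => // k; rewrite andTb; elim: k => [|k IHk] lekn.
  by rewrite /= /entry /= invg1.
have [_ u_cycle] := g_tower k.+2 lekn.
rewrite (wordS g k.+1).
rewrite word_prod_cat word_prod_nseq word_prod_rcons IHk ?(ltnW lekn) //.
have /eqP := full_cycle_expg lekn u_cycle.
rewrite expgS -eq_invg_mul => /eqP<-.
by rewrite /fmul invMg invgK mulKg.
Qed.

Lemma prefix_block (T : eqType) (w s : seq T) a i j : (i <= j)%N -> prefix s w ->
  prefix (flatten (nseq i (rcons w a)) ++ s) (flatten (nseq j (rcons w a)) ++ w).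
Proof.
move=> leij s_w; rewrite -(subnKC leij) nseqD flatten_cat -catA.
rewrite prefix_catr // eqxx /=; case: (j - i)%N => [|m] //=.
by rewrite cat_rcons -catA; apply: prefix_catl.
Qed.

(** For x in G_k, some power u_k ^+ j agrees with x at the point k, so that
    u_k ^+ j undone from x lies in G_{k-1}, where the induction hypothesis
    gives a prefix s of M_{k-1}; then j blocks followed by s reach x. *)
Lemma word_visits_symG n (g : seq 'S_n) k (x : 'S_n) :
    tower g -> (0 < k <= n)%N -> x \in symG n k ->
  exists2 s, prefix s (word g k) & word_prod s = x.
Proof.
move=> g_tower; case: k => // k; rewrite andTb; elim: k x => [|k IHk] x lekn xG.
  by exists [::] => //; rewrite (symG1 _ xG).
have [_ u_cycle] := g_tower k.+2 lekn.
set u := fmul _ _ in u_cycle.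
(* The largest point of the initial segment. *)
pose i := Ordinal lekn.
have [j ltjk xi] : exists2 j, (j < k.+2)%N & x i = (u ^+ j) i.
  have : x i \in porbit u i.
    rewrite (full_cycle_porbit u_cycle) //.
    move: xG; rewrite in_symG => /perm_closed->.
    by rewrite mem_initial_segment.
  case/porbitP=> j ->; exists (j %% k.+2)%N; first by rewrite ltn_mod.
  by rewrite expg_mod // full_cycle_expg.
have [|s s_w sE] := IHk (x * (u ^+ j)^-1) (ltnW lekn).
  apply: (@symG_fix _ _ _ i); [by [] | | by rewrite permM xi permK].
  by case/andP: u_cycle => uG _; rewrite groupM ?groupV ?groupX.
exists (flatten (nseq j (rcons (word g k.+1) (entry g k.+2))) ++ s).
  exact: prefix_block.
rewrite word_prod_cat word_prod_nseq word_prod_rcons sE word_prod_tower //.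
  by rewrite mulgKV.
exact: ltnW.
Qed.

Lemma mem_entry n (g : n.-1.-tuple 'S_n) k :
  (2 <= k <= n)%N -> entry g k \in (g : seq 'S_n).
Proof.
case: k => [|[|k]] //= lekn; rewrite /entry /= mem_nth // size_tuple.
by case: n g lekn => // n' _.
Qed.

Lemma mem_word n (g : n.-1.-tuple 'S_n) k :
  (k <= n)%N -> {subset word g k <= (g : seq 'S_n)}.
Proof.
elim: k => // k IHk lekn x; rewrite wordS mem_cat => /orP[|]; last first.
  exact/IHk/ltnW.
case/flattenP=> s; rewrite mem_nseq => /andP[k_gt0 /eqP->].
rewrite mem_rcons inE => /predU1P[->|]; first by rewrite mem_entry // ltnS k_gt0.
exact/IHk/ltnW.
Qed.

Lemma size_closed_word n (g : seq 'S_n) :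
  (0 < n)%N -> size (closed_word g) = n`!.
Proof. by case: n g => // n g _; rewrite size_rcons size_word. Qed.

(** * The cycle of a tower *)

(* The products of prefixes, as opposed to partial products of groups. *)
Local Notation partial_product := Defs.partial_product.

Lemma partial_productE n (g : seq 'S_n) m :
  partial_product g m = word_prod (take m (closed_word g)).
Proof. by []. Qed.

Lemma partial_product0 n (g : seq 'S_n) : partial_product g 0 = 1.
Proof. by rewrite partial_productE take0. Qed.

Lemma partial_productS n (g : seq 'S_n) m : (0 < n)%N -> (m < n`!)%N ->
  partial_product g m.+1 =
  fmul (partial_product g m) (nth 1 (closed_word g) m).
Proof.
move=> n_gt0 ltm; rewrite !partial_productE (take_nth 1) ?size_closed_word //.
by rewrite word_prod_rcons.
Qed.

Lemma partial_product_fact n (g : seq 'S_n) : tower g -> (0 < n)%N ->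
  partial_product g n`! = 1.
Proof.
move=> g_tower n_gt0; rewrite partial_productE -(size_closed_word g n_gt0).
by rewrite take_size word_prod_rcons word_prod_tower ?mulgV // n_gt0 leqnn.
Qed.

Lemma partial_product_pred_fact n (g : seq 'S_n) : tower g -> (0 < n)%N ->
  partial_product g n`!.-1 = (entry g n)^-1.
Proof.
move=> g_tower n_gt0; rewrite -word_prod_tower ?n_gt0 ?leqnn //.
rewrite partial_productE -(size_closed_word g n_gt0) size_rcons /=.
by rewrite /closed_word -cats1 take_size_cat.
Qed.

Lemma partial_product_surj n (g : seq 'S_n) (x : 'S_n) :
    tower g -> (0 < n)%N ->
  exists2 m, (m < n`!)%N & x = partial_product g m.
Proof.
move=> g_tower n_gt0.
have [|s s_w <-] := word_visits_symG g_tower _ (symGT x); first by rewrite n_gt0 leqnn.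
exists (size s).
  by rewrite -(size_closed_word g n_gt0) size_rcons ltnS size_prefix.
rewrite partial_productE; congr word_prod; apply/eqP; rewrite eq_sym -prefixE.
by rewrite /closed_word -cats1 prefix_catl.
Qed.

(** The n! vertices of the walk exhaust a group of order n!. *)
Lemma partial_product_inj n (g : seq 'S_n) : tower g -> (0 < n)%N ->
  {in gtn n`! &, injective (partial_product g)}.
Proof.
move=> g_tower n_gt0; apply/mkseq_uniqP.
apply: (leq_size_uniq (enum_uniq 'S_n)) => [x _|]; last first.
  by rewrite size_mkseq -cardE card_Sn.
have [m ltm ->] := partial_product_surj x g_tower n_gt0.
by rewrite map_f // mem_iota.
Qed.

(** Each M_{k+1} starts with M_k g_{k+1}, and M_k has k! - 1 letters: every
    entry of the tower can be read off the word. *)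
Lemma nth_closed_word n (g : seq 'S_n) k : (0 < k < n)%N ->
  nth 1 (closed_word g) k`!.-1 = entry g k.+1.
Proof.
move=> kn; have /prefixP[s ->] := word_prefix_closed_word g kn.
case: k kn => // k _; rewrite -(size_word g) nth_cat size_rcons ltnSn.
by rewrite nth_rcons ltnn eqxx.
Qed.

Lemma partial_product1 n (g : seq 'S_n) : (1 < n)%N ->
  partial_product g 1 = entry g 2.
Proof.
move=> n_gt1; rewrite partial_productS ?fact_gt0 ?(ltnW n_gt1) //.
by rewrite partial_product0 /fmul mulg1 (@nth_closed_word _ _ 1).
Qed.

Lemma fact_gt2 n : (2 < n)%N -> (2 < n`!)%N.
Proof. by move=> n_gt2; apply: leq_trans (@leq_fact 3 n n_gt2). Qed.

(** An undirected cycle could be run through in two directions from 1; the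
    vertex preceding 1 on the cycle of h is h_n^-1, which is outside G_{n-1},
    whereas g_2 is inside. *)
Lemma tower_cycle_second_vertex n (g h : seq 'S_n) : (2 < n)%N ->
    tower g -> tower h -> tower_cycle g = tower_cycle h ->
  partial_product g 1 = partial_product h 1.
Proof.
move=> n_gt2 g_tower h_tower gh; have n_gt0 : (0 < n)%N by apply: leq_trans n_gt2.
have: [set partial_product g 0; partial_product g 1] \in tower_cycle h.
  by rewrite -gh; apply/imsetP; exists (Ordinal (fact_gt0 n)).
case/imsetP=> -[j ltj] _ /= /set2_eq; rewrite partial_product0.
have h_inj := partial_product_inj h_tower n_gt0.
case=> -[].
  rewrite -(partial_product0 h) => /h_inj <- //; exact: fact_gt0.
have [ltj1|lej1] := ltnP j.+1 n`!.
  by rewrite -(partial_product0 h) => /(h_inj _ _ (fact_gt0 n) ltj1).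
have -> : j = n`!.-1.
  by have -> : n`! = j.+1 by apply/eqP; rewrite eqn_leq lej1 ltj.
move=> _; rewrite partial_product_pred_fact // partial_product1 ?(ltnW n_gt2) //.
move=> g2E; have [] := h_tower n; first by rewrite leqnn (ltnW n_gt2).
case/setDP=> _ /negP[]; rewrite -groupV -g2E.
have [] := g_tower 2; first by rewrite (ltnW n_gt2).
case/setDP=> g2 _ _; apply: subsetP g2.
by apply: symG_sub; rewrite -ltnS prednK.
Qed.

Lemma tower_cycle_hamiltonian n (g : n.-1.-tuple 'S_n) :
  (2 < n)%N -> tower g ->
  hamiltonian_cycle (cayley [set a in g]) (tower_cycle g).
Proof.
move=> n_gt2 g_tower; have n_gt0 : (0 < n)%N by apply: leq_trans n_gt2.
apply: closed_walk_hamiltonian => [|||x|m ltm].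
- exact: fact_gt2.
- exact: partial_product_inj.
- by rewrite partial_product0 partial_product_fact.
- exact: partial_product_surj.
apply/existsP; exists (nth 1 (closed_word g) m).
rewrite partial_productS // eqxx andbT inE.
have: nth 1 (closed_word g) m \in closed_word g.
  by rewrite mem_nth ?size_closed_word.
rewrite mem_rcons inE => /predU1P[->|].
  by rewrite mem_entry // leqnn (ltnW n_gt2).
exact: mem_word.
Qed.

Lemma tower_cycle_inj n (g h : n.-1.-tuple 'S_n) :
  (2 < n)%N -> tower g -> tower h -> tower_cycle g = tower_cycle h -> g = h.
Proof.
move=> n_gt2 g_tower h_tower gh; have n_gt0 : (0 < n)%N by apply: leq_trans n_gt2.
have pE m : (m <= n`!)%N -> partial_product g m = partial_product h m.
  apply: closed_walk_unique => //.
  - exact: fact_gt2.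
  - exact: partial_product_inj.
  - exact: partial_product_inj.
  - by rewrite partial_product0 partial_product_fact.
  - by rewrite partial_product0 partial_product_fact.
  - by rewrite !partial_product0.
  exact: tower_cycle_second_vertex.
apply/val_inj/(@eq_from_nth _ 1); rewrite ?size_tuple // => i lti.
have ltin : (i.+1 < n)%N by rewrite -ltn_predRL.
have ltm : (i.+1`!.-1 < n`!)%N.
  by rewrite prednK ?fact_gt0 // leq_fact // ltnW.
have := pE _ ltm; rewrite !partial_productS // pE 1?ltnW // !nth_closed_word //.
by move/mulIg.
Qed.

Theorem corollary3p5 (n : nat) (hn : (3 <= n)%N) :
  (forall g : n.-1.-tuple 'S_n, tower g ->
     hamiltonian_cycle (cayley [set a in g]) (tower_cycle g))
  /\
  (forall g h : n.-1.-tuple 'S_n, tower g -> tower h ->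
     g <> h -> tower_cycle g <> tower_cycle h).
Proof.
split=> [g|g h g_tower h_tower gh E]; first exact: tower_cycle_hamiltonian.
exact/gh/tower_cycle_inj.
Qed.
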